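(* Let $V$ be a finite set with $|V|=n$. Suppose $\alpha=\sum_{\ell=2}^n w_\ell\,\alpha^\ell$ for some nonnegative vector $w=(w_2,\dots,w_n)$, where $\alpha^\ell$ denotes the collection of weights $\alpha^\ell_A=\mathbf 1_{|A|=\ell}$, $A\subset V$. Then $$\lambda[\alpha,\mathcal S_n]=\sum_{\ell=2}^n\frac{n\,w_\ell}{\ell}\binom{n-2}{\ell-2},$$ and equality in the inequality $$\lambda\,\mathrm{Var} f\le\sum_{A\subset V}\alpha_A\,\mu[\mathrm{Var}_A f]$$ (with $\lambda=\lambda[\alpha,\mathcal S_n]$) is uniquely achieved at mean zero functions of a single particle. In particular, the identity $\lambda[\alpha,\mathcal S_n]=\lambda(G)$, where $G$ is the weighted graph on $V$ with edge weights $c_{xy}=\sum_{A\subset V:\,A\ni x,y}\frac{\alpha_A}{|A|}$ (conjectured to hold for arbitrary weights $\alpha$), holds whenever $\alpha_A$ is a function of the cardinality $|A|$ only.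
   Context: $\mathcal S_n$ is the set of the $n!$ permutations, viewed as vectors $\sigma=(\sigma_x)_{x\in V}$ assigning to the vertices of $V$ the distinct labels $1,\dots,n$; $\sigma_x=i$ means that the particle with label $i$ is at vertex $x$, and $\xi=\sigma^{-1}$, so that $\xi_i\in V$ is the position of particle $i$. A function of a single particle is a function of the form $f(\sigma)=\varphi(\xi_i)$ for some label $i$ and some $\varphi:V\to\mathbb R$. $\mu$ is the uniform distribution on $\mathcal S_n$. For $A\subset V$ and $f:\mathcal S_n\to\mathbb R$, $\mu_A f=\mu[f\mid\sigma_z,\ z\notin A]$ is the conditional expectation given the labels at all vertices outside $A$, $\mathrm{Var}_A f=\mu_A[(f-\mu_Af)^2]$, and $\mathrm{Var} f=\mathrm{Var}_V f$. For a collection of nonnegative weights $\alpha=\{\alpha_A,\ A\subset V\}$, the spectral gap $\lambda[\alpha,\mathcal S_n]$ is the largest $\lambda\ge0$ such that $\lambda\,\mathrm{Var} f\le\sum_{A\subset V}\alpha_A\,\mu[\mathrm{Var}_A f]$ for all $f:\mathcal S_n\to\mathbb R$. For a weighted graph $G$ on $V$ with symmetric weights $c_{xy}\ge0$, the spectral gap $\lambda(G)$ is the second smallest eigenvalue of $-\mathcal L$, where $\mathcal L f(x)=\sum_{y\in V}c_{xy}[f(y)-f(x)]$ for $f:V\to\mathbb R$.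
   Formalization: Here n ≥ 2; ''uniquely achieved'' means that the mean zero functions attaining equality are exactly the linear combinations of mean zero functions of a single particle, and uniqueness is claimed only if n = 2 or w_ℓ > 0 for some ℓ < n (otherwise every f attains equality). *)

(* Defs.v *)
From HB Require Import structures.
From mathcomp Require Import all_boot all_order all_algebra all_fingroup.
From mathcomp Require Import reals.

Set Implicit Arguments.
Unset Strict Implicit.
Unset Printing Implicit Defensive.

Import Order.TTheory GRing.Theory Num.Theory.

Local Open Scope ring_scope.

(* A configuration assigns to the vertices of V the labels 'I_#|V|
   (0, ..., n-1 instead of 1, ..., n).  Composing with the bijection
   [enum_rank : V -> 'I_#|V|] identifies these assignments with {perm V}. *)
Section Configurations.
Variable V : finType.

Definition label (s : {perm V}) (x : V) : 'I_#|V| := enum_rank (s x).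

Definition position (s : {perm V}) (i : 'I_#|V|) : V :=
  (s^-1)%g (enum_val i).

Lemma labelK (s : {perm V}) : cancel (label s) (position s).
Proof. by move=> x; rewrite /label /position enum_rankK permK. Qed.

Lemma positionK (s : {perm V}) : cancel (position s) (label s).
Proof. by move=> i; rewrite /label /position permKV enum_valK. Qed.

Lemma label_surj (g : V -> 'I_#|V|) :
  injective g -> exists s : {perm V}, label s =1 g.
Proof.
move=> injg.
have inj : injective (fun x => enum_val (g x)).
  by move=> x y /enum_val_inj /injg.
by exists (perm inj) => x; rewrite /label permE enum_valK.
Qed.

Lemma label_inj (s t : {perm V}) : label s =1 label t -> s = t.
Proof. by move=> st; apply/permP => x; apply: enum_rank_inj; apply: st. Qed.

End Configurations.

Section Functionals.
Variables (R : realType) (V : finType).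
Implicit Types (A : {set V}) (f : {perm V} -> R) (alpha : {set V} -> R).

Definition mean f : R := (\sum_(s : {perm V}) f s) / #|{perm V}|%:R.

Definition same_outside A (s : {perm V}) : {set {perm V}} :=
  [set t : {perm V} | [forall z, (z \notin A) ==> (label t z == label s z)]].

(* Conditioning the uniform measure on the labels outside A amounts to
   averaging over the configurations having the same labels outside A. *)
Definition cond_mean A f : {perm V} -> R := fun s =>
  (\sum_(t in same_outside A s) f t) / #|same_outside A s|%:R.

Definition cond_var A f : {perm V} -> R :=
  cond_mean A (fun s => (f s - cond_mean A f s) ^+ 2).

Definition variance f : R := mean (fun s => (f s - mean f) ^+ 2).

Lemma cond_meanT f s : cond_mean setT f s = mean f.
Proof.
have -> : cond_mean setT f s = (\sum_(t in [set: {perm V}]) f t)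
                               / #|[set: {perm V}]|%:R.
  suff E : same_outside setT s = setT by rewrite /cond_mean E.
  by apply/setP => t; rewrite !inE; apply/forallP => z; rewrite inE.
by rewrite cardsT /mean; congr (_ / _); apply: eq_bigl => t; rewrite inE.
Qed.

Lemma cond_varT f s : cond_var setT f s = variance f.
Proof.
rewrite /cond_var cond_meanT /variance /mean; congr (_ / _).
by apply: eq_bigr => t _; rewrite cond_meanT.
Qed.

Definition dirichlet alpha f : R :=
  \sum_(A : {set V}) alpha A * mean (cond_var A f).

(* [lam] is the largest nonnegative constant in the Poincare inequality. *)
Definition is_spectral_gap alpha (lam : R) : Prop :=
  [/\ 0 <= lam,
      forall f, lam * variance f <= dirichlet alpha f
    & forall lam', 0 <= lam' ->
        (forall f, lam' * variance f <= dirichlet alpha f) -> lam' <= lam].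

Lemma is_spectral_gap_unique alpha lam1 lam2 :
  is_spectral_gap alpha lam1 -> is_spectral_gap alpha lam2 -> lam1 = lam2.
Proof.
move=> [p1 i1 m1] [p2 i2 m2]; apply/eqP; rewrite eq_le.
by rewrite (m2 _ p1 i1) (m1 _ p2 i2).
Qed.

Definition level_weight (l : nat) : {set V} -> R := fun A => (#|A| == l)%:R.

Definition single_particle f : Prop :=
  exists (i : 'I_#|V|) (phi : V -> R), forall s, f s = phi (position s i).

Definition mean_zero_single_particle f : Prop :=
  single_particle f /\ mean f = 0.

Definition in_span (P : ({perm V} -> R) -> Prop) f : Prop :=
  exists (m : nat) (a : 'I_m -> R) (g : 'I_m -> {perm V} -> R),
    (forall k, P (g k)) /\ (forall s, f s = \sum_(k < m) a k * g k s).

End Functionals.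

Section WeightedGraphs.
Variables (R : realType) (V : finType).

Definition laplacian (c : V -> V -> R) (f : V -> R) : V -> R :=
  fun x => \sum_(y : V) c x y * (f y - f x).

(* Matrix of the operator - laplacian c in the canonical basis of V -> R. *)
Definition neg_laplacian_mx (c : V -> V -> R) : 'M[R]_#|V| :=
  \matrix_(i, j)
    - laplacian c (fun x => (x == enum_val j)%:R) (enum_val i).

(* Eigenvalues are counted with multiplicity and listed in increasing order. *)
Definition is_second_smallest_eigenvalue n (M : 'M[R]_n) (lam : R) : Prop :=
  exists (a : R) (s : seq R),
    sorted <=%R [:: a, lam & s] /\
    char_poly M = \prod_(b <- [:: a, lam & s]) ('X - b%:P).

Lemma is_second_smallest_eigenvalue_unique n (M : 'M[R]_n) lam1 lam2 :
  is_second_smallest_eigenvalue M lam1 ->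
  is_second_smallest_eigenvalue M lam2 -> lam1 = lam2.
Proof.
move=> [a1 [s1 [o1 e1]]] [a2 [s2 [o2 e2]]].
have /prod_XsubC_eq pe : \prod_(b <- [:: a1, lam1 & s1]) ('X - b%:P) =
    \prod_(b <- [:: a2, lam2 & s2]) ('X - b%:P) by rewrite -e1 -e2.
by have [] := le_sorted_eq o1 o2 pe.
Qed.

Definition is_graph_gap (c : V -> V -> R) (lam : R) : Prop :=
  is_second_smallest_eigenvalue (neg_laplacian_mx c) lam.

Definition edge_weight (alpha : {set V} -> R) (x y : V) : R :=
  \sum_(A : {set V} | (x \in A) && (y \in A)) alpha A / #|A|%:R.

End WeightedGraphs.

(* Main.v *)
Require Import Defs.
From HB Require Import structures.
From mathcomp Require Import all_boot all_order all_algebra all_fingroup.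
From mathcomp Require Import reals.
From mathcomp Require Import ring.

Set Implicit Arguments.
Unset Strict Implicit.
Unset Printing Implicit Defensive.

Import Order.TTheory GRing.Theory Num.Theory.

Local Open Scope ring_scope.

(* Fix B with |B| = m and let P_A = cond_mean A, an orthogonal projection.  The
   operator Q = sum_(x in B) (P_(B - x) - P_B) satisfies
   Q^2 = m / (m - 1) Q, so (m - 1) / m Q is itself an orthogonal projection, and
   its nonnegative complement gives
     sum_(x in B) mu[Var_(B - x) f] >= m (m - 2) / (m - 1) mu[Var_B f]
   with an explicit square as defect.  Summing over all B of size m shows that
   sum_(|A| = l) mu[Var_A f], divided by its expected gap, is nonincreasing in l;
   at l = n it equals Var f.  Equality at some l < n forces the defect at
   B = V to vanish, which writes f as a sum of functions of one label.
   Conversely, on functions of a single particle the generator of the block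
   dynamics acts as the graph Laplacian, here that of the complete graph. *)

(** * Conditional means as averages over the permutations supported in a block *)

Section SymSums.
Variables (R : realType) (V : finType).
Implicit Types (A B : {set V}) (x y : V) (u s : {perm V}) (f : {perm V} -> R).

Lemma mem_Sym A u : (u \in Sym A) = perm_on A u.
Proof. by rewrite inE. Qed.

Lemma Sym_fix A u x : u \in Sym A -> x \notin A -> u x = x.
Proof. by rewrite mem_Sym; apply: out_perm. Qed.

Lemma Sym_tperm A x y : x \in A -> y \in A -> tperm x y \in Sym A.
Proof.
move=> xA yA; rewrite mem_Sym; apply: subset_trans (tperm_on x y) _.
by apply/subsetP => z; rewrite !inE => /orP[] /eqP ->.
Qed.

Lemma SymS A B u : A \subset B -> u \in Sym A -> u \in Sym B.
Proof. by rewrite !mem_Sym => AB uA; apply: subset_trans uA AB. Qed.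

(** Products apply the left factor first, so right multiplication by [tperm x y] brings the image y
    of x back to x: the elements of [Sym B] sending x to y form one coset of the stabilizer of x. *)
Lemma Sym_tpermM B x y u : x \in B -> y \in B ->
  ((u * tperm x y)%g \in Sym (B :\ x)) = (u \in Sym B) && (u x == y).
Proof.
move=> xB yB; apply/idP/andP => [uB|[uB /eqP uxy]].
  split; first by rewrite -(groupMr _ (Sym_tperm xB yB)) (SymS _ uB)// subD1set.
  have /(congr1 (tperm x y)) : (u * tperm x y)%g x = x.
    by rewrite (Sym_fix uB)// !inE eqxx.
  by rewrite permM tpermK tpermL => H; apply/eqP.
rewrite mem_Sym; apply/subsetP => z; rewrite !inE permM.
have [->|zx] /= := eqVneq z x; first by rewrite uxy tpermR eqxx.
apply: contraNT => zB; rewrite (Sym_fix uB)// tpermD 1?eq_sym//.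
by apply: contraNneq zB => ->.
Qed.

Lemma sum_Sym B x (F : {perm V} -> R) : x \in B ->
  \sum_(u in Sym B) F u =
  \sum_(y in B) \sum_(u in Sym (B :\ x)) F (u * tperm x y)%g.
Proof.
move=> xB; rewrite (partition_big (fun u : {perm V} => u x) (mem B)) /=; last first.
  by move=> u; rewrite mem_Sym => /perm_closed ->.
apply: eq_bigr => y yB; rewrite [RHS](reindex_inj (mulIg (tperm x y))) /=.
apply: eq_big => u; first by rewrite Sym_tpermM.
by rewrite -mulgA tperm2 mulg1.
Qed.

Lemma sum_SymV B (F : {perm V} -> R) :
  \sum_(u in Sym B) F u = \sum_(u in Sym B) F u^-1%g.
Proof.
by rewrite (reindex_inj invg_inj); apply: eq_bigl => u /=; rewrite groupV.
Qed.

Lemma sum_Sym_left B x (F : {perm V} -> R) : x \in B ->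
  \sum_(u in Sym B) F u =
  \sum_(y in B) \sum_(u in Sym (B :\ x)) F (tperm x y * u)%g.
Proof.
move=> xB; rewrite sum_SymV (sum_Sym _ xB); apply: eq_bigr => y _.
rewrite sum_SymV; apply: eq_bigr => u _.
by rewrite invMg invgK tpermV.
Qed.

Lemma card_Sym_neq0 A : #|Sym A|%:R != 0 :> R.
Proof. by rewrite pnatr_eq0 -lt0n card_Sym fact_gt0. Qed.

Lemma card_SymD1 B x : x \in B ->
  #|Sym B|%:R = #|B|%:R * #|Sym (B :\ x)|%:R :> R.
Proof.
by move=> xB; rewrite !card_Sym (cardsD1 x B) xB add1n factS natrM.
Qed.

(** [t * s^-1] sends z to the vertex where s carries the label that t puts at z, so it fixes z
    exactly when the two labels agree. The class of s is therefore the coset [Sym A * s]. *)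
Lemma same_outsideE A s t : (t \in same_outside A s) = ((t * s^-1)%g \in Sym A).
Proof.
rewrite inE mem_Sym; apply/forallP/subsetP => H z.
  rewrite !inE; apply: contraNT => zA; move: (implyP (H z) zA).
  rewrite /label (inj_eq enum_rank_inj) => /eqP E.
  by rewrite permM E permK.
apply/implyP => zA; rewrite /label (inj_eq enum_rank_inj).
rewrite -(inj_eq (@perm_inj _ s^-1%g)) permK -permM.
by apply: contraNT zA => zA; apply: H; rewrite inE.
Qed.

Lemma cond_meanE A f s :
  cond_mean A f s = (\sum_(u in Sym A) f (u * s)%g) / #|Sym A|%:R.
Proof.
rewrite /cond_mean; congr (_ / _%:R).
  rewrite (reindex_inj (mulIg s)); apply: eq_bigl => u.
  by rewrite /= same_outsideE mulgK.
rewrite -[RHS](card_imset _ (mulIg s)); congr #|pred_of_set _|; apply/setP => t.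
rewrite same_outsideE; apply/idP/imsetP => [H|[u uA ->]]; last by rewrite mulgK.
by exists (t * s^-1)%g; rewrite ?mulgKV.
Qed.

Lemma cond_mean_mul A f u s : u \in Sym A ->
  cond_mean A f (u * s)%g = cond_mean A f s.
Proof.
move=> uA; rewrite !cond_meanE; congr (_ / _).
rewrite [RHS](reindex_inj (mulIg u)); apply: eq_big => v /=.
  by rewrite groupMr.
by rewrite mulgA.
Qed.

Lemma cond_mean_mull A f u s : u \in Sym A ->
  cond_mean A (fun t => f (u * t)%g) s = cond_mean A f s.
Proof.
move=> uA; rewrite !cond_meanE; congr (_ / _).
rewrite [RHS](reindex_inj (mulgI u)); apply: eq_big => v /=.
  by rewrite groupMl.
by rewrite mulgA.
Qed.

Lemma cond_meanD A f g s :
  cond_mean A (fun t => f t + g t) s = cond_mean A f s + cond_mean A g s.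
Proof. by rewrite /cond_mean big_split mulrDl. Qed.

Lemma cond_meanZ A a f s :
  cond_mean A (fun t => a * f t) s = a * cond_mean A f s.
Proof. by rewrite /cond_mean -mulr_sumr mulrA. Qed.

Lemma cond_mean_sum A (I : finType) (P : pred I) (F : I -> {perm V} -> R) s :
  cond_mean A (fun t => \sum_(i | P i) F i t) s =
  \sum_(i | P i) cond_mean A (F i) s.
Proof. by rewrite /cond_mean exchange_big mulr_suml. Qed.

Lemma cond_mean_const A (a : R) s : cond_mean A (fun=> a) s = a.
Proof.
by rewrite cond_meanE sumr_const -[a *+ _]mulr_natr mulfK ?card_Sym_neq0.
Qed.

Lemma cond_mean_inv A f s :
  (forall u, u \in Sym A -> f (u * s)%g = f s) -> cond_mean A f s = f s.
Proof.
move=> H; rewrite cond_meanE (eq_bigr (fun=> f s) H) sumr_const.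
by rewrite -[f s *+ _]mulr_natr mulfK ?card_Sym_neq0.
Qed.

Lemma cond_mean_fix A B f s : A \subset B ->
  cond_mean A (cond_mean B f) s = cond_mean B f s.
Proof.
by move=> AB; apply: cond_mean_inv => u uA; rewrite cond_mean_mul// (SymS AB).
Qed.

Lemma cond_mean_tower A B f s : A \subset B ->
  cond_mean B (cond_mean A f) s = cond_mean B f s.
Proof.
move=> AB; rewrite cond_meanE (eq_bigr _ (fun u _ => cond_meanE A f _)).
rewrite -mulr_suml exchange_big /=.
rewrite (eq_bigr (fun=> \sum_(u in Sym B) f (u * s)%g)) => [|v vA]; last first.
  rewrite [RHS](reindex_inj (mulgI v)); apply: eq_big => u.
    by rewrite groupMl// (SymS AB).
  by rewrite mulgA.
rewrite sumr_const -[X in X / _ / _]mulr_natr mulfK ?card_Sym_neq0//.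
by rewrite cond_meanE.
Qed.

(** Conditions on the label that x receives: after resampling B it is uniform among the labels [s y]
    with y in B, and [tperm x y * s] is a configuration with [s y] at x. *)
Lemma card_cond_mean B x f s : x \in B ->
  #|B|%:R * cond_mean B f s =
  \sum_(y in B) cond_mean (B :\ x) f (tperm x y * s)%g.
Proof.
move=> xB; rewrite (eq_bigr _ (fun y _ => cond_meanE _ f _)) -mulr_suml.
have B0 : #|B|%:R != 0 :> R by rewrite (cardsD1 x) xB pnatr_eq0.
rewrite cond_meanE (card_SymD1 xB) (sum_Sym _ xB).
under eq_bigr do under eq_bigr do rewrite -mulgA.
by field; rewrite B0 card_Sym_neq0.
Qed.

(** The dual decomposition: it conditions on the vertex y of B to which the particle initially at x
    is moved. *)
Lemma card_cond_mean_left B x f s : x \in B ->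
  #|B|%:R * cond_mean B f s =
  \sum_(y in B) cond_mean (B :\ x) (fun t => f (tperm x y * t)%g) s.
Proof.
move=> xB; rewrite (eq_bigr _ (fun y _ => cond_meanE _ _ _)) -mulr_suml.
have B0 : #|B|%:R != 0 :> R by rewrite (cardsD1 x) xB pnatr_eq0.
rewrite cond_meanE (card_SymD1 xB) (sum_Sym_left _ xB).
under eq_bigr do under eq_bigr do rewrite -mulgA.
by field; rewrite B0 card_Sym_neq0.
Qed.

End SymSums.

(** * Conditional means as orthogonal projections *)

Section Projections.
Variables (R : realType) (V : finType).
Implicit Types (A B : {set V}) (x y : V) (u s : {perm V}) (f g : {perm V} -> R).

Lemma eq_mean f g : f =1 g -> mean f = mean g.
Proof. by move=> fg; rewrite /mean; congr (_ / _); apply: eq_bigr. Qed.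

Lemma eq_cond_mean A f g : f =1 g -> cond_mean A f =1 cond_mean A g.
Proof.
by move=> fg s; rewrite /cond_mean; congr (_ / _); apply: eq_bigr.
Qed.

Lemma meanD f g : mean (fun s => f s + g s) = mean f + mean g.
Proof. by rewrite -!(cond_meanT _ 1%g) cond_meanD. Qed.

Lemma meanZ a f : mean (fun s => a * f s) = a * mean f.
Proof. by rewrite -!(cond_meanT _ 1%g) cond_meanZ. Qed.

Lemma meanN f : mean (fun s => - f s) = - mean f.
Proof.
by rewrite -mulN1r -meanZ; apply: eq_mean => s; rewrite mulN1r.
Qed.

Lemma meanB f g : mean (fun s => f s - g s) = mean f - mean g.
Proof. by rewrite meanD meanN. Qed.

Lemma mean_sum (I : finType) (P : pred I) (F : I -> {perm V} -> R) :
  mean (fun t => \sum_(i | P i) F i t) = \sum_(i | P i) mean (F i).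
Proof.
rewrite -(cond_meanT _ 1%g) cond_mean_sum.
by apply: eq_bigr => i _; rewrite cond_meanT.
Qed.

Lemma mean_const (a : R) : mean (fun _ : {perm V} => a : R) = a :> R.
Proof. by rewrite -(cond_meanT (V := V) _ 1%g) cond_mean_const. Qed.

Lemma card_perm_gt0 : 0 < #|{perm V}|%:R :> R.
Proof. by rewrite ltr0n; apply/card_gt0P; exists 1%g. Qed.

Lemma mean_ge0 f : (forall s, 0 <= f s) -> 0 <= mean f.
Proof.
by move=> f0; rewrite /mean divr_ge0 ?sumr_ge0// ltW ?card_perm_gt0.
Qed.

Lemma mean_eq0 f : (forall s, 0 <= f s) -> mean f = 0 -> forall s, f s = 0.
Proof.
move=> f0 /eqP; rewrite mulf_eq0 invr_eq0 (gt_eqF card_perm_gt0) orbF => /eqP.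
by move=> /psumr_eq0P H s; apply: H.
Qed.

Lemma mean_cond_mean A f : mean (cond_mean A f) = mean f.
Proof.
by rewrite -!(cond_meanT _ 1%g) cond_mean_tower ?subsetT.
Qed.

Lemma cond_mean_pull A f g s :
  cond_mean A (fun t => f t * cond_mean A g t) s =
  cond_mean A f s * cond_mean A g s.
Proof.
rewrite [LHS]cond_meanE (cond_meanE A f) mulrAC; congr (_ / _).
rewrite mulr_suml.
by apply: eq_bigr => u uA; rewrite cond_mean_mul.
Qed.

Lemma mean_mul_cond_mean A f g :
  mean (fun s => f s * cond_mean A g s) =
  mean (fun s => cond_mean A f s * cond_mean A g s).
Proof.
rewrite -(mean_cond_mean A); apply: eq_mean => s; exact: cond_mean_pull.
Qed.

Lemma cond_mean_adj A f g :
  mean (fun s => f s * cond_mean A g s) = mean (fun s => cond_mean A f s * g s).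
Proof.
rewrite mean_mul_cond_mean; under eq_mean do rewrite mulrC.
by rewrite -mean_mul_cond_mean; under eq_mean do rewrite mulrC.
Qed.

Lemma mean_cond_var A f :
  mean (cond_var A f) =
  mean (fun s => f s * f s) - mean (fun s => f s * cond_mean A f s).
Proof.
rewrite mean_cond_mean.
rewrite (eq_mean (g := fun s => f s * f s - 2 * (f s * cond_mean A f s)
    + cond_mean A f s * cond_mean A f s)); last by move=> s; ring.
by rewrite meanD meanB meanZ -mean_mul_cond_mean; ring.
Qed.

(** A permutation supported on at most one vertex is the identity, so such blocks resample
    nothing. *)
Lemma mean_cond_var_small A f : (#|A| <= 1)%N -> mean (cond_var A f) = 0.
Proof.
move=> A1; rewrite mean_cond_var; apply/eqP; rewrite subr_eq0; apply/eqP.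
apply: eq_mean => s; congr (_ * _); rewrite cond_mean_inv// => u.
by rewrite mem_Sym => uA; rewrite (perm_on_id uA A1) mul1g.
Qed.

Lemma mem_SymD1 B x u : x \in B ->
  (u \in Sym (B :\ x)) = (u \in Sym B) && (u x == x).
Proof. by move=> xB; rewrite -Sym_tpermM// tperm1 mulg1. Qed.

(** * The local identity on a block B with m elements *)

Section Local.
Variable B : {set V}.
Let m : R := #|B|%:R.

(** Expand P_B h by [card_cond_mean_left]. The term at x is [h s]; the other m - 1 terms agree,
    since conjugation by [tperm y z] turns [tperm x y] into [tperm x z] and h is invariant under
    [Sym (B :\ x)]. *)
Lemma cond_mean_swap x y f s : x \in B -> y \in B -> y != x ->
  let h := cond_mean (B :\ x) f in
  (m - 1) * cond_mean (B :\ x) (fun t => h (tperm x y * t)%g) s =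
  m * cond_mean B f s - h s.
Proof.
move=> xB yB yx h.
have <- : cond_mean B h s = cond_mean B f s by rewrite cond_mean_tower ?subD1set.
rewrite (card_cond_mean_left _ _ xB) (big_setD1 x)//=.
have -> : cond_mean (B :\ x) (fun t => h (tperm x x * t)%g) s = h s.
  rewrite -[RHS](cond_mean_fix f s (subxx (B :\ x))); apply: eq_cond_mean => t.
  by rewrite tperm1 mul1g.
rewrite addrC addrK.
rewrite (eq_bigr (fun=> cond_mean (B :\ x) (fun t => h (tperm x y * t)%g) s)).
  rewrite sumr_const -[X in _ = X]mulr_natl /m (cardsD1 x B) xB natrD.
  by rewrite addrAC subrr add0r.
move=> z; rewrite !inE => /andP[zx zB]; have [->//|zy] := eqVneq z y.
have yz : tperm y z \in Sym (B :\ x) by rewrite Sym_tperm ?inE ?yx ?zx.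
rewrite -(cond_mean_mull (fun t => h (tperm x y * t)%g) s yz).
apply: eq_cond_mean => t; rewrite /h -[LHS](cond_mean_mul f _ yz) !mulgA.
have -> : tperm x z = (tperm x y ^ tperm y z)%g.
  by rewrite tpermJ tpermL tpermD// eq_sym.
by rewrite conjgE !mulgA mulgV mul1g.
Qed.

(** Conjugation by [tperm x y] exchanges the stabilizers of y and x in [Sym B]. *)
Lemma cond_mean_conj x y f s : x \in B -> y \in B ->
  cond_mean (B :\ y) f s =
  cond_mean (B :\ x) (fun t => f (tperm x y * t)%g) (tperm x y * s)%g.
Proof.
move=> xB yB; rewrite !cond_meanE; congr (_ / _%:R); last first.
  rewrite !card_Sym; move: (cardsD1 x B) (cardsD1 y B).
  by rewrite xB yB => -> /addnI ->.
set t := tperm x y; rewrite (reindex_inj (conjg_inj t)).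
apply: eq_big => u; last by rewrite conjgE tpermV !mulgA.
have tB : t \in Sym B by apply: Sym_tperm.
rewrite !mem_SymD1// groupJr//= conjgE tpermV !permM tpermR.
by congr (_ && _); rewrite -[RHS](inj_eq (@perm_inj _ t)) tpermL.
Qed.

(** The term y = x is h itself. For y != x, conjugation and [cond_mean_swap] leave m P_B f minus a
    translate of h, and by [card_cond_mean] these translates add up to m P_B f - h. *)
Lemma sum_cond_mean2 x f s : x \in B ->
  (m - 1) * \sum_(y in B) cond_mean (B :\ y) (cond_mean (B :\ x) f) s =
  m * cond_mean (B :\ x) f s + m * (m - 2) * cond_mean B f s.
Proof.
move=> xB; set h := cond_mean (B :\ x) f.
rewrite (big_setD1 x)//= {1}/h cond_mean_fix// -/h mulrDr mulr_sumr.
have E y : y \in B :\ x -> (m - 1) * cond_mean (B :\ y) h s =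
    m * cond_mean B f s - h (tperm x y * s)%g.
  rewrite !inE => /andP[yx yB].
  rewrite (cond_mean_conj _ _ xB yB) cond_mean_swap//.
  by rewrite cond_mean_mul ?Sym_tperm.
rewrite (eq_bigr _ E) sumrB sumr_const.
have <- : m * cond_mean B f s - h s =
    \sum_(y in B :\ x) h (tperm x y * s)%g.
  by rewrite (card_cond_mean _ _ xB) (big_setD1 x)//= -/h tperm1 mul1g;
  rewrite addrAC subrr add0r.
rewrite -[_ *+ _]mulr_natl.
have -> : #|B :\ x|%:R = m - 1 :> R.
  by rewrite /m (cardsD1 x B) xB natrD addrAC subrr add0r.
ring.
Qed.

(** In the notation of the overview this is f - P_B f - (m - 1) / m Q f. Since Q P_B = 0, for m >= 2
    it is the orthogonal projection of f onto the complement of the ranges of P_B and Q. *)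
Definition local_defect f s : R :=
  f s - (m - 1) / m * \sum_(x in B) cond_mean (B :\ x) f s
  + (m - 2) * cond_mean B f s.

(** With D the projection giving the defect, this is <f, D f> = <D f, D f> multiplied by m / (m -
    1). *)
Lemma local_gap_identity f : (2 <= #|B|)%N ->
  \sum_(x in B) mean (cond_var (B :\ x) f)
  - m * (m - 2) / (m - 1) * mean (cond_var B f) =
  m / (m - 1) * mean (fun s => local_defect f s ^+ 2).
Proof.
move=> B2.
have m0 : m != 0 by rewrite pnatr_eq0 -lt0n (leq_trans _ B2).
have m1 : m - 1 != 0 by rewrite subr_eq0 pnatr_eq1 gtn_eqF.
(* This [Q] is uncentred: the operator of the overview is [Q] - m P_B. *)
pose Q g s := \sum_(x in B) cond_mean (B :\ x) g s.
have QQ s : Q (Q f) s = (m * Q f s + m ^+ 2 * (m - 2) * cond_mean B f s) / (m - 1).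
  apply: (mulfI m1); rewrite mulrCA mulfV// mulr1.
  rewrite /Q (eq_bigr _ (fun y _ => cond_mean_sum _ _ _ _)) exchange_big /=.
  rewrite mulr_sumr (eq_bigr _ (fun x xB => sum_cond_mean2 f s xB)).
  rewrite big_split /= -mulr_sumr sumr_const -[_ *+ _]mulr_natl -/m; ring.
have dotQ g h : mean (fun s => g s * Q h s) = mean (fun s => Q g s * h s).
  under eq_mean do rewrite /Q mulr_sumr.
  under [RHS]eq_mean do rewrite /Q mulr_suml.
  by rewrite !mean_sum; apply: eq_bigr => x _; apply: cond_mean_adj.
set a := mean (fun s => f s * f s).
set b := mean (fun s => f s * Q f s).
set c := mean (fun s => f s * cond_mean B f s).
have bE : b = \sum_(x in B) mean (fun s => f s * cond_mean (B :\ x) f s).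
  by rewrite /b -mean_sum; apply: eq_mean => s; rewrite mulr_sumr.
have QQE : mean (fun s => Q f s * Q f s) = (m * b + m ^+ 2 * (m - 2) * c) / (m - 1).
  rewrite -dotQ.
  rewrite (eq_mean (g := fun s => m / (m - 1) * (f s * Q f s) +
    m ^+ 2 * (m - 2) / (m - 1) * (f s * cond_mean B f s))) => [|s]; last first.
    by rewrite QQ; field.
  by rewrite meanD !meanZ -/b -/c; field.
have QPE : mean (fun s => Q f s * cond_mean B f s) = m * c.
  rewrite -dotQ -meanZ; apply: eq_mean => s.
  rewrite /Q (eq_bigr (fun=> cond_mean B f s)) => [|x xB]; last first.
    by rewrite cond_mean_fix// subD1set.
  by rewrite sumr_const -[_ *+ _]mulr_natl -/m; ring.
(* Expanding the square leaves six quadratic forms; [QQE], [QPE] and the projection property of P_B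
   reduce them to [a], [b] and [c]. *)
rewrite [in RHS](eq_mean (g := fun s => f s * f s
   - 2 * (m - 1) / m * (f s * Q f s)
   + 2 * (m - 2) * (f s * cond_mean B f s)
   + ((m - 1) / m) ^+ 2 * (Q f s * Q f s)
   - 2 * (m - 1) / m * (m - 2) * (Q f s * cond_mean B f s)
   + (m - 2) ^+ 2 * (cond_mean B f s * cond_mean B f s))); last first.
  by move=> s; rewrite /local_defect -/(Q f s); field.
rewrite !(meanD, meanN, meanZ) QQE QPE -mean_mul_cond_mean -/a -/b -/c.
rewrite (eq_bigr _ (fun x _ => mean_cond_var _ _)) sumrB -bE sumr_const.
rewrite -[_ *+ _]mulr_natl -/m mean_cond_var -/a -/c.
by field; rewrite m0 m1.
Qed.

End Local.
End Projections.

(** * Monotonicity of the normalized variances in the block size *)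

Section Levels.
Variables (R : realType) (V : finType).
Implicit Types (A B : {set V}) (x y : V) (f : {perm V} -> R).

(** Double counting: a set A of size m equals [B :\ x] once for each x outside A, with B = A + x.
    For m > |V| the truncated difference is 0 and both sums are empty. *)
Lemma sum_level_remove (h : {set V} -> R) m :
  \sum_(B : {set V} | #|B| == m.+1) \sum_(x in B) h (B :\ x) =
  (#|V| - m)%:R * \sum_(A : {set V} | #|A| == m) h A.
Proof.
rewrite (exchange_big_dep predT) //=.
under eq_bigr => x _.
  rewrite (reindex_onto (fun A => x |: A) (fun B => B :\ x)) /=; last first.
    by move=> B /andP[_ xB]; rewrite setD1K.
  rewrite (eq_bigl (fun A => (#|A| == m) && (x \notin A))); last first.
    move=> A; rewrite setU11 andbT cardsU1; case: (boolP (x \in A)) => xA /=.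
      rewrite andbF; apply/negP => /andP[_ /eqP] /setP /(_ x).
      by rewrite !inE eqxx xA.
    by rewrite add1n eqSS setU1K// eqxx.
  over.
rewrite /= (exchange_big_dep (fun A => #|A| == m)) => [|x A _ /andP[]]//=.
rewrite mulr_sumr; apply: eq_bigr => A /eqP Am.
rewrite (eq_bigr (fun=> h A)) => [|x /andP[_ xA]]; last by rewrite setU1K.
rewrite (eq_bigl (mem (~: A))) => [|x]; last by rewrite /= inE Am eqxx.
by rewrite sumr_const -[_ *+ _]mulr_natl cardsCs setCK Am.
Qed.

Definition level_var l f : R :=
  \sum_(A : {set V} | #|A| == l) mean (cond_var A f).

(** For l >= 2, a pair of vertices lies in 'C(n - 2, l - 2) blocks of size l, each adding 1 / l to
    its edge weight; the complete graph with constant weight a has gap n a. *)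
Definition level_gap l : R := #|V|%:R / l%:R * 'C(#|V| - 2, l - 2)%:R.

Lemma level_step m f : (1 <= m)%N ->
  m.+1%:R * (m%:R - 1) / m%:R * level_var m.+1 f <=
  (#|V| - m)%:R * level_var m f.
Proof.
move=> m1; rewrite /level_var -sum_level_remove mulr_sumr; apply: ler_sum => B.
move=> /eqP Bm; rewrite -subr_ge0.
have := @local_gap_identity R V B f; rewrite Bm ltnS m1 => /(_ isT).
have -> : m.+1%:R - 1 = m%:R :> R by rewrite -natr1 addrK.
have -> : m.+1%:R - 2 = m%:R - 1 :> R by rewrite -natr1; ring.
move=> ->; apply: mulr_ge0; first by rewrite divr_ge0.
by apply: mean_ge0 => s; apply: sqr_ge0.
Qed.

Lemma level_gap_gt0 l : (2 <= l <= #|V|)%N -> 0 < level_gap l.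
Proof.
move=> /andP[l2 ln]; rewrite mulr_gt0 ?divr_gt0 ?ltr0n ?bin_gt0 ?leq_sub2r//.
  by rewrite (leq_trans _ ln)// (leq_trans _ l2).
by rewrite (leq_trans _ l2).
Qed.

(** [level_gap] solves with equality the recursion that [level_var] satisfies as an inequality in
    [level_step], which makes their ratio monotone. *)
Lemma level_gap_step m : (2 <= m < #|V|)%N ->
  (#|V| - m)%:R * level_gap m = m.+1%:R * (m%:R - 1) / m%:R * level_gap m.+1.
Proof.
case: m => [|[|k]]// /andP[_ kn]; rewrite /level_gap !subSS !subn0.
have := mul_bin_left (#|V| - 2) k; rewrite -subnDA add2n.
move=> /(congr1 (fun n => n%:R : R)); rewrite !natrM => E.
have -> : k.+2%:R - 1 = k.+1%:R :> R by rewrite -natr1 addrK.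
have N j : j.+1%:R != 0 :> R by rewrite pnatr_eq0.
transitivity (#|V|%:R / k.+2%:R * ((#|V| - k.+2)%:R * 'C(#|V| - 2, k)%:R) : R).
  by move: (N k.+1); move: (k.+2%:R : R) => a a0; field.
rewrite -E; move: (N k.+1) (N k.+2).
by move: (k.+2%:R : R) (k.+3%:R : R) => a b a0 b0; field; rewrite a0 b0.
Qed.

Lemma level_ratio_step m f : (2 <= m < #|V|)%N ->
  level_var m.+1 f / level_gap m.+1 <= level_var m f / level_gap m.
Proof.
move=> /andP[m2 mn].
have g0 : 0 < level_gap m by rewrite level_gap_gt0// m2 ltnW.
have g1 : 0 < level_gap m.+1 by rewrite level_gap_gt0// mn (leq_trans m2).
rewrite ler_pdivrMr// mulrAC ler_pdivlMr//.
have d0 : 0 < (#|V| - m)%:R :> R by rewrite ltr0n subn_gt0.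
rewrite -(ler_pM2l d0) mulrCA level_gap_step ?m2//.
rewrite [X in X <= _](_ : _ =
  m.+1%:R * (m%:R - 1) / m%:R * level_var m.+1 f * level_gap m.+1); last by ring.
rewrite [leRHS]mulrA; apply: ler_wpM2r; first exact: ltW.
by apply: level_step; apply: leq_trans m2.
Qed.

Lemma level_ratio_le l k f : (2 <= l)%N -> (l <= k <= #|V|)%N ->
  level_var k f / level_gap k <= level_var l f / level_gap l.
Proof.
move=> l2; elim: k => [|k IH] /andP[]; first by rewrite leqNgt (leq_trans _ l2).
rewrite leq_eqVlt => /predU1P[-> //|lk kn].
apply: le_trans (level_ratio_step f _) (IH _); last by rewrite -ltnS lk ltnW.
by rewrite kn (leq_trans l2).
Qed.

Lemma level_var_top f : level_var #|V| f = variance f.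
Proof.
rewrite /level_var (big_pred1 setT) => [|A].
  by rewrite (eq_mean (cond_varT f)) mean_const.
by rewrite /= eqEcard subsetT cardsT eqn_leq max_card.
Qed.

Lemma level_gap_top : (2 <= #|V|)%N -> level_gap #|V| = 1.
Proof.
move=> n2; rewrite /level_gap binn mulr1 divff//.
by rewrite pnatr_eq0 -lt0n (leq_trans _ n2).
Qed.

Lemma level_var_ge l f : (2 <= l <= #|V|)%N ->
  level_gap l * variance f <= level_var l f.
Proof.
move=> /andP[l2 ln]; have := level_ratio_le f l2 (k := #|V|).
rewrite ln leqnn level_var_top level_gap_top ?(leq_trans l2)// divr1 => /(_ isT).
by rewrite ler_pdivlMr ?level_gap_gt0 ?l2// mulrC.
Qed.

(** The local identity for B = V, whose blocks [setT :\ x] are exactly the sets of size n - 1. *)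
Lemma level_var_predn f : (2 <= #|V|)%N ->
  level_var #|V|.-1 f - #|V|%:R * (#|V|%:R - 2) / (#|V|%:R - 1) * variance f =
  #|V|%:R / (#|V|%:R - 1) * mean (fun s => local_defect setT f s ^+ 2).
Proof.
move=> n2; have := @local_gap_identity R V setT f; rewrite cardsT => /(_ n2) <-.
rewrite (eq_mean (cond_varT f)) mean_const; congr (_ - _).
have := sum_level_remove (fun A => mean (cond_var A f)) #|V|.-1.
have n0 : (0 < #|V|)%N by rewrite (leq_trans _ n2).
have -> : (#|V| - #|V|.-1 = 1)%N by rewrite -{1}(prednK n0) subSnn.
rewrite mul1r /level_var => <-; rewrite (big_pred1 setT) // => A.
by rewrite /= eqEcard subsetT cardsT prednK// eqn_leq max_card.
Qed.

(** The ratio at n - 1 lies between those at l and at n. Equality at l makes all three equal to Var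
    f, so the square in [level_var_predn] has mean zero. *)
Lemma level_var_eq_defect l f : (2 <= l < #|V|)%N ->
  level_gap l * variance f = level_var l f -> forall s, local_defect setT f s = 0.
Proof.
move=> /andP[l2 ln] E.
have n0 : (0 < #|V|)%N by rewrite (leq_ltn_trans _ ln).
have ln' : (l <= #|V|.-1)%N by rewrite -ltnS prednK.
have n3 : (2 < #|V|)%N by rewrite (leq_ltn_trans l2).
have nV2 : (2 <= #|V|)%N := ltnW n3.
have n2 : (2 <= #|V|.-1)%N by rewrite -ltnS prednK.
have N1 : 0 < #|V|%:R - 1 :> R by rewrite subr_gt0 ltr1n ltnW.
have := level_ratio_le f l2 (k := #|V|.-1); rewrite ln' leq_pred => /(_ isT).
rewrite -E [X in _ <= X]mulrAC divff ?mul1r; last first.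
  by rewrite gt_eqF// level_gap_gt0// l2 ltnW.
rewrite ler_pdivrMr ?level_gap_gt0 ?n2 ?leq_pred// => H.
have := @level_gap_step #|V|.-1; rewrite n2 prednK// leqnn => /(_ isT).
have -> : (#|V| - #|V|.-1 = 1)%N by rewrite -{1}(prednK n0) subSnn.
rewrite mul1r level_gap_top// mulr1 => G.
have NE : #|V|.-1%:R = #|V|%:R - 1 :> R by rewrite -{2}(prednK n0) -natr1 addrK.
have Z : mean (fun s => local_defect setT f s ^+ 2) <= 0.
  have c0 : 0 < #|V|%:R / (#|V|%:R - 1) :> R by rewrite divr_gt0 ?ltr0n.
  rewrite -(ler_pM2l c0) mulr0 -level_var_predn// subr_le0.
  rewrite (le_trans H)// G NE le_eqVlt; apply/orP; left; apply/eqP.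
  by field; rewrite gt_eqF.
have := mean_eq0 (f := fun s => local_defect setT f s ^+ 2) (fun s => sqr_ge0 _).
move=> /(_ _) D s; apply/eqP; rewrite -sqrf_eq0; apply/eqP; apply: D.
by apply/eqP; rewrite eq_le Z mean_ge0// => t; apply: sqr_ge0.
Qed.

(** For n = 2 both terms on the left of [level_var_predn] vanish: blocks of size 1 have no variance,
    and the coefficient contains n - 2. *)
Lemma local_defect_card2 f : #|V| = 2%N -> forall s, local_defect setT f s = 0.
Proof.
move=> n2 s; have := @level_var_predn f; rewrite n2 leqnn subrr mulr0 !mul0r subr0.
rewrite {1}/level_var big1 => [|A /eqP A1]; last first.
  by rewrite mean_cond_var_small ?A1.
move=> /(_ isT)/esym/eqP; rewrite (_ : 2 - 1 = 1 :> R) ?divr1; last by ring.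
rewrite mulf_eq0 pnatr_eq0 /= => /eqP H; apply/eqP; rewrite -sqrf_eq0; apply/eqP.
exact: (mean_eq0 (fun s => sqr_ge0 _) H).
Qed.

End Levels.

(** * Weights depending on the cardinality, and their action on one particle *)

Section CardinalityWeights.
Variables (R : realType) (V : finType).
Implicit Types (A B : {set V}) (x y : V) (f : {perm V} -> R).

(** Complements of such sets are the (n - l)-element subsets of V without x and y. *)
Lemma card_sets_containing2 x y l : x != y -> (2 <= l <= #|V|)%N ->
  #|[set A : {set V} | [&& #|A| == l, x \in A & y \in A]]| =
  'C(#|V| - 2, l - 2).
Proof.
move=> xy /andP[l2 ln].
have cxy : #|~: [set x; y]| = (#|V| - 2)%N by rewrite cardsCs setCK cards2 xy.
rewrite -bin_sub ?leq_sub2r// subnBA// subnK ?(leq_trans l2)//.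
rewrite -cxy -cards_draws -[RHS](card_imset _ (inv_inj (@setCK V))).
apply: eq_card => A; rewrite inE; apply/and3P/imsetP => [[/eqP Al xA yA]|[B]].
  exists (~: A); last by rewrite setCK.
  rewrite inE setCS subUset !sub1set xA yA /= cardsCs setCK Al.
  by rewrite eqxx.
rewrite inE subsetC subUset !sub1set !inE => /andP[/andP[xB yB] /eqP Bl] ->.
by rewrite !inE cardsCs setCK Bl subKn.
Qed.

Lemma sum_by_level (alpha : {set V} -> R) (w : nat -> R) (P : pred {set V})
    (h : {set V} -> R) :
  (forall A, (2 <= #|A|)%N -> alpha A = w #|A|) ->
  (forall A, P A -> (#|A| <= 1)%N -> h A = 0) ->
  \sum_(A : {set V} | P A) alpha A * h A =
  \sum_(2 <= l < #|V|.+1) w l * \sum_(A : {set V} | P A && (#|A| == l)) h A.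
Proof.
move=> alphaE h0.
have -> : \sum_(2 <= l < #|V|.+1) w l * \sum_(A | P A && (#|A| == l)) h A =
    \sum_(2 <= l < #|V|.+1) \sum_(A | P A) (#|A| == l)%:R * w l * h A.
  apply: eq_bigr => l _; rewrite mulr_sumr big_mkcondr; apply: eq_bigr => A _.
  by case: eqP; rewrite !(mul1r, mul0r).
rewrite exchange_big /=; apply: eq_bigr => A PA.
have [A1|A2] := leqP #|A| 1.
  by rewrite (h0 _ PA A1) mulr0 big1// => l _; rewrite mulr0.
rewrite (bigD1_seq #|A|) ?iota_uniq ?mem_index_iota ?A2 ?ltnS ?max_card//=.
rewrite eqxx mul1r -alphaE// big1 ?addr0// => l /negPf.
by rewrite eq_sym => ->; rewrite !mul0r.
Qed.

Section Weights.
Variables (alpha : {set V} -> R) (w : nat -> R).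
Hypothesis n_ge2 : (2 <= #|V|)%N.
Hypothesis alphaE : forall A, (2 <= #|A|)%N -> alpha A = w #|A|.

Let lam : R := \sum_(2 <= l < #|V|.+1) w l * level_gap R V l.

Let n_neq0 : #|V|%:R != 0 :> R.
Proof. by rewrite pnatr_eq0 -lt0n (leq_trans _ n_ge2). Qed.

Lemma dirichlet_levels f :
  dirichlet alpha f = \sum_(2 <= l < #|V|.+1) w l * level_var l f.
Proof.
rewrite /dirichlet (sum_by_level alphaE) => [//|A _].
exact: mean_cond_var_small.
Qed.

(** The graph is thus complete with constant weight off the diagonal; diagonal weights are
    multiplied by zero in the Laplacian. *)
Lemma edge_weight_levels x y : x != y -> edge_weight alpha x y = lam / #|V|%:R.
Proof.
move=> xy; rewrite /edge_weight (sum_by_level alphaE) => [|A /andP[xA yA]]; last first.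
  by move=> /card_le1_eqP /(_ _ _ xA yA) E; rewrite E eqxx in xy.
rewrite /lam mulr_suml; apply: eq_big_nat => l /andP[l2 ln].
rewrite -mulrA; congr (_ * _); rewrite /level_gap.
rewrite (eq_bigr (fun=> l%:R^-1)) => [|A /andP[_ /eqP ->]//].
rewrite (eq_bigl (mem [set A : {set V} | [&& #|A| == l, x \in A & y \in A]])).
  rewrite sumr_const card_sets_containing2 ?l2//.
  by rewrite -[_ *+ _]mulr_natl; field; rewrite n_neq0 pnatr_eq0 -lt0n (leq_trans _ l2).
by move=> A; rewrite /= inE andbC.
Qed.

End Weights.

(** Resampling A makes the position of particle i uniform in A if the particle is there, and
    otherwise does not move it. *)
Lemma cond_mean_position A f (phi : V -> R) i s :
  (forall t, f t = phi (position t i)) ->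
  cond_mean A f s = if position s i \in A
    then (\sum_(y in A) phi y) / #|A|%:R else f s.
Proof.
move=> fE; case: ifPn => pA; last first.
  apply: cond_mean_inv => u uA; rewrite !fE /position invMg permM.
  by rewrite (Sym_fix _ pA)// groupV.
have A0 : #|A|%:R != 0 :> R by rewrite (cardsD1 (position s i)) pA pnatr_eq0.
apply: (mulfI A0); rewrite [RHS]mulrCA mulfV// mulr1.
rewrite (card_cond_mean_left _ _ pA); apply: eq_bigr => y yA.
have E u : u \in Sym (A :\ position s i) ->
    f (tperm (position s i) y * (u * s))%g = phi y.
  move=> uA; rewrite fE /position !invMg !permM tpermV.
  rewrite -/(position s i) (Sym_fix (groupVr uA)) ?inE ?eqxx//.
  by rewrite tpermL.
rewrite cond_meanE (eq_bigr _ E) sumr_const -[_ *+ _]mulr_natr mulfK//.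
exact: card_Sym_neq0.
Qed.

(** Only blocks containing the position p contribute, each with [alpha A / #|A|] times the sum over
    y in A of phi p - phi y; exchanging the sums over A and y collects the edge weights. *)
Lemma single_particle_generator (alpha : {set V} -> R) f (phi : V -> R) i s :
  (forall t, f t = phi (position t i)) ->
  \sum_A alpha A * (f s - cond_mean A f s) =
  - laplacian (edge_weight alpha) phi (position s i).
Proof.
move=> fE; set p := position s i.
rewrite (bigID (fun A => p \in A)) /= addrC big1 ?add0r => [|A /negPf pA]; last first.
  by rewrite (cond_mean_position _ _ fE) -/p pA subrr mulr0.
rewrite /laplacian /edge_weight -sumrN.
under [RHS]eq_bigr do rewrite mulr_suml -sumrN.
rewrite (exchange_big_dep (fun A => p \in A)) => [|y A _ /andP[]]//=.
apply: eq_bigr => A pA; rewrite (cond_mean_position _ _ fE) -/p pA fE -/p.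
have A0 : #|A|%:R != 0 :> R by rewrite (cardsD1 p) pA pnatr_eq0.
rewrite (eq_bigl (mem A)) => [|y]; last by [].
rewrite sumrN -mulr_sumr sumrB sumr_const -[_ *+ _]mulr_natl; field.
exact: A0.
Qed.

(** * The spectral gap and its extremal functions *)

Section SpectralGap.
Variables (alpha : {set V} -> R) (w : nat -> R).
Hypothesis n_ge2 : (2 <= #|V|)%N.
Hypothesis alphaE : forall A, (2 <= #|A|)%N -> alpha A = w #|A|.
Hypothesis w_ge0 : forall l, (2 <= l <= #|V|)%N -> 0 <= w l.

Let lam : R := \sum_(2 <= l < #|V|.+1) w l * level_gap R V l.

Lemma mean_zero_single_particle_eigen f s : mean_zero_single_particle f ->
  \sum_A alpha A * (f s - cond_mean A f s) = lam * f s.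
Proof.
move=> [[i [phi fE]] f0]; rewrite (single_particle_generator _ _ fE).
set p := position s i.
(* The position of a particle is uniform on V, so the mean of f is the average of phi. *)
have phi0 : \sum_y phi y = 0.
  apply/eqP; move/eqP: f0; rewrite -(cond_meanT _ s) (cond_mean_position _ _ fE).
  rewrite inE cardsT mulf_eq0 invr_eq0 pnatr_eq0 -(subnKC n_ge2) orbF.
  by rewrite (eq_bigl xpredT) => // y; rewrite inE.
rewrite /laplacian (eq_bigr (fun y => lam / #|V|%:R * (phi y - phi p))); last first.
  move=> y _; have [->|yp] := eqVneq y p; first by rewrite subrr !mulr0.
  by rewrite (edge_weight_levels n_ge2 alphaE)// eq_sym.
rewrite -mulr_sumr sumrB phi0 sumr_const -[_ *+ _]mulr_natl fE -/p.
by field; rewrite pnatr_eq0 -(subnKC n_ge2).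
Qed.

Lemma in_span_eigen f : in_span (@mean_zero_single_particle R V) f ->
  mean f = 0 /\
  forall s, \sum_A alpha A * (f s - cond_mean A f s) = lam * f s.
Proof.
move=> [m [a [g [gP fE]]]]; split.
  rewrite (eq_mean fE) mean_sum big1// => k _.
  by rewrite meanZ (gP k).2 mulr0.
move=> s.
transitivity (\sum_(k < m) a k *
    \sum_A alpha A * (g k s - cond_mean A (g k) s)).
  under [RHS]eq_bigr do rewrite mulr_sumr.
  rewrite exchange_big /=; apply: eq_bigr => A _.
  rewrite (eq_cond_mean A fE) cond_mean_sum fE -sumrB mulr_sumr.
  by apply: eq_bigr => k _; rewrite cond_meanZ; ring.
rewrite fE mulr_sumr; apply: eq_bigr => k _.
by rewrite mean_zero_single_particle_eigen// mulrCA.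
Qed.

Lemma variance_mean0 f : mean f = 0 -> variance f = mean (fun s => f s * f s).
Proof. by move=> f0; apply: eq_mean => s; rewrite f0 subr0 expr2. Qed.

(** Pair the eigenvalue equation of [in_span_eigen] with f and take means. *)
Lemma in_span_equality f : in_span (@mean_zero_single_particle R V) f ->
  lam * variance f = dirichlet alpha f.
Proof.
move=> /in_span_eigen[f0 fE]; rewrite variance_mean0// -meanZ.
transitivity (mean (fun s => \sum_A alpha A * (f s * f s - f s * cond_mean A f s))).
  apply: eq_mean => s; rewrite mulrCA -fE mulr_sumr.
  by apply: eq_bigr => A _; ring.
rewrite mean_sum; apply: eq_bigr => A _.
by rewrite meanZ meanB mean_cond_var.
Qed.

Lemma in_span_mem (P : ({perm V} -> R) -> Prop) f : P f -> in_span P f.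
Proof.
move=> Pf; exists 1%N, (fun=> 1), (fun=> f); split=> // s.
by rewrite big_ord1 mul1r.
Qed.

Lemma level_spectral_gap : is_spectral_gap alpha lam.
Proof.
split.
- rewrite /lam big_nat sumr_ge0// => l /andP[l2 ln].
  by rewrite mulr_ge0 ?w_ge0 ?l2// ltW// level_gap_gt0// l2.
- move=> f; rewrite (dirichlet_levels alphaE) /lam mulr_suml.
  rewrite big_nat [leRHS]big_nat; apply: ler_sum => l /andP[l2 ln].
  by rewrite -mulrA ler_wpM2l ?w_ge0 ?l2// level_var_ge// l2.
move=> lam' _ H.
have [x0 _] : exists x : V, x \in V by apply/card_gt0P; rewrite (leq_trans _ n_ge2).
(* Optimality is tested on one nonzero extremal function: the centred indicator that a given
   particle sits at x0. At the identity it equals 1 - 1 / n, which is nonzero as n >= 2. *)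
pose phi x : R := (x == x0)%:R - #|V|%:R^-1.
pose f s := phi (position s (enum_rank x0)).
have nn : #|V|%:R != 0 :> R by rewrite pnatr_eq0 -(subnKC n_ge2).
have fE t : f t = phi (position t (enum_rank x0)) by [].
have f0 : mean f = 0.
  rewrite -(cond_meanT _ 1%g) (cond_mean_position _ _ fE).
  rewrite inE (eq_bigl xpredT) => [|y]; last by rewrite inE.
  rewrite sumrB sumr_const -[_ *+ _]mulr_natl mulfV// (bigD1 x0)//= eqxx.
  by rewrite big1 ?addr0 ?subrr ?mul0r// => y /negPf ->.
have fP : mean_zero_single_particle f by split; first by exists (enum_rank x0), phi.
have v0 : 0 < variance f.
  rewrite variance_mean0// lt_def mean_ge0 ?andbT => [|s]; last first.
    by rewrite -expr2 sqr_ge0.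
  apply/eqP => /mean_eq0 E.
  have /eqP : f 1%g * f 1%g = 0 by apply: E => s; rewrite -expr2 sqr_ge0.
  rewrite mulf_eq0 orbb /f /position enum_rankK invg1 perm1 /phi eqxx.
  by rewrite subr_eq0 eq_sym invr_eq1 pnatr_eq1 gtn_eqF.
have := H f; rewrite -(in_span_equality (in_span_mem fP)).
by rewrite ler_pM2r.
Qed.

(** With mean zero, vanishing defect gives f = (n - 1) / n times the sum over x of the conditional
    means of f given the label at x. Summing over labels i instead, with x the position of i,
    exhibits single-particle functions. *)
Lemma defect_in_span f : mean f = 0 -> (forall s, local_defect setT f s = 0) ->
  in_span (@mean_zero_single_particle R V) f.
Proof.
move=> f0 D.
pose c : R := (#|V|%:R - 1) / #|V|%:R.
(* The transposition serves as a representative configuration with label i at x; the conditional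
   mean depends on nothing else. *)
pose psi (i : 'I_#|V|) x := cond_mean (setT :\ x) f (tperm x (enum_val i)).
pose g i s := psi i (position s i).
exists #|V|, (fun=> c), (fun i s => g i s - mean (g i)); split=> [i|s].
  split; last by rewrite meanB mean_const subrr.
  by exists i, (fun x => psi i x - mean (g i)).
have fE t : f t = \sum_i c * g i t.
  have := D t; rewrite /local_defect cond_meanT f0 mulr0 addr0 cardsT.
  move=> /eqP; rewrite subr_eq0 => /eqP ->.
  rewrite -mulr_sumr -/c; congr (_ * _);
  rewrite (eq_bigl xpredT) => [|x]; last by rewrite inE.
  rewrite (reindex (fun i => position t i)); last first.
    by exists (label t) => x _; [exact: positionK | exact: labelK].
  apply: eq_bigr => i _; rewrite /g /psi; set x := position t i.
  have tx : t x = enum_val i by rewrite /x /position permKV.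
  rewrite -(@cond_mean_mul _ _ _ _ (t * tperm x (enum_val i))%g
    (tperm x (enum_val i))).
    by rewrite -mulgA tperm2 mulg1.
  by rewrite mem_SymD1 ?in_setT// permM tx tpermR eqxx andbT mem_Sym;
  apply/subsetP => z; rewrite in_setT.
under eq_bigr do rewrite mulrBr.
rewrite sumrB -fE.
(* The constants subtracted to centre the summands add up to the mean of f, which is zero. *)
have -> : \sum_(i < #|V|) c * mean (g i) = mean f.
  by rewrite (eq_mean fE) mean_sum; apply: eq_bigr => i _; rewrite meanZ.
by rewrite f0 subr0.
Qed.

(** Equality makes a sum of nonnegative terms vanish, hence each term, and a level l < n of positive
    weight yields zero defect. For n = 2 there is no such level, but every defect vanishes. *)
Lemma equality_in_span f :
  (#|V| = 2%N \/ exists l, (2 <= l < #|V|)%N /\ 0 < w l) ->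
  mean f = 0 -> lam * variance f = dirichlet alpha f ->
  in_span (@mean_zero_single_particle R V) f.
Proof.
move=> [n2|[l [/andP[l2 ln] wl]]] f0 E; apply: defect_in_span => //.
  exact: local_defect_card2.
apply: (level_var_eq_defect (l := l)); first by rewrite l2.
have F0 k : (2 <= k < #|V|.+1)%N ->
    0 <= w k * (level_var k f - level_gap R V k * variance f).
  move=> k2; rewrite mulr_ge0 ?w_ge0// subr_ge0.
  exact: level_var_ge.
have S : \sum_(2 <= k < #|V|.+1)
    w k * (level_var k f - level_gap R V k * variance f) = 0.
  under eq_bigr do rewrite mulrBr.
  rewrite sumrB -(dirichlet_levels alphaE) -E /lam mulr_suml.
  by under eq_bigr do rewrite -mulrA; rewrite subrr.
move: S; rewrite big_nat => /eqP; rewrite psumr_eq0 => [/allP/(_ l)|//].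
rewrite mem_index_iota l2 ltnS ltnW//= => /(_ isT).
by rewrite mulf_eq0 gt_eqF//= subr_eq0 => /eqP.
Qed.

End SpectralGap.
End CardinalityWeights.

(** * Spectrum of the complete graph, and the conclusion *)

Lemma char_poly_intertwine (F : fieldType) n (A X T : 'M[F]_n) :
  \det T != 0 -> T *m A = X *m T -> char_poly A = char_poly X.
Proof.
move=> T0 E; have T0' : \det (map_mx polyC T) != 0.
  by rewrite det_map_mx polyC_eq0.
apply: (mulfI T0'); rewrite /char_poly -det_mulmx mulrC -det_mulmx.
by rewrite /char_poly_mx mulmxBr mulmxBl -!map_mxM E scalar_mxC.
Qed.

(* T replaces the first basis vector by the all-ones eigenvector and makes the
   matrix triangular. *)
Lemma complete_graph_eigenvalue (R : realType) n (a : R) (M : 'M[R]_n) :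
  (2 <= n)%N -> 0 <= a ->
  (forall i j, M i j = a * (n%:R * (i == j)%:R - 1)) ->
  is_second_smallest_eigenvalue M (n%:R * a).
Proof.
case: n M => [|[|n]]// M _ a0 ME.
have na0 : 0 <= n.+2%:R * a by rewrite mulr_ge0.
pose T : 'M[R]_n.+2 := \matrix_(i, j) ((i == j) || (i == 0))%:R.
pose X : 'M[R]_n.+2 :=
  \matrix_(i, j) (a * (n.+2%:R * (i == j)%:R - (j == 0)%:R) * (i != 0)%:R).
have detT : \det T = 1.
  rewrite -det_tr det_trig => [|]; last first.
    apply/is_trig_mxP => i j ij; rewrite !mxE.
    by rewrite -!val_eqE /= gtn_eqF//= gtn_eqF// (leq_ltn_trans _ ij).
  by rewrite big1// => i _; rewrite !mxE eqxx.
have TM : T *m M = X *m T.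
  apply/matrixP => i j; rewrite !mxE.
  have [->|i0] := eqVneq i 0.
    rewrite [RHS]big1 => [|k _]; last by rewrite !mxE eqxx mulr0 mul0r.
    rewrite (eq_bigr (fun k => a * (n.+2%:R * (k == j)%:R - 1))) => [|k _]; last first.
      by rewrite mxE ME eqxx orbT mul1r.
    rewrite -mulr_sumr sumrB -mulr_sumr (bigD1 j)//= eqxx big1 => [|k /negPf ->//].
    by rewrite sumr_const card_ord addr0 mulr1 subrr mulr0.
  rewrite (bigD1 i)//= big1 => [|k /negPf ki]; last first.
    by rewrite mxE eq_sym ki (negPf i0) mul0r.
  rewrite mxE eqxx mul1r addr0 ME (bigD1 0)//= !mxE eqxx orbT.
  rewrite (eq_bigr (fun k => a * n.+2%:R * ((i == k) && (k == j))%:R)); last first.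
    move=> k /negPf k0; rewrite !mxE k0 orbF (negPf i0) subr0 !mulr1 -mulrA.
    by rewrite -mulnb natrM !mulrA.
  rewrite -mulr_sumr (bigD1 i)//= eqxx (negPf i0) big1 => [|k /andP[_ /negPf ki]].
    by rewrite /=; ring.
  by rewrite eq_sym ki.
(* In dimension [n.+2] the eigenvalue [n.+2%:R * a] occurs [n.+1] times: once as the second entry
   and n times in the tail. *)
exists 0, (nseq n (n.+2%:R * a)); split.
  rewrite /= na0 /=; elim: {2}n => //= k IH.
  by rewrite lexx IH.
have T0 : \det T != 0 by rewrite detT oner_neq0.
rewrite (char_poly_intertwine T0 TM) char_poly_trig; last first.
  apply/is_trig_mxP => i j ij; rewrite mxE -!val_eqE /= ltn_eqF//.
  rewrite gtn_eqF ?(leq_ltn_trans _ ij)//.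
  by rewrite mulr0 subrr mulr0 mul0r.
rewrite big_ord_recl !big_cons; congr (_ * _).
  by rewrite mxE eqxx mulr0.
rewrite (eq_bigr (fun=> 'X - (n.+2%:R * a)%:P)) => [|i _].
  by rewrite big_ord_recl; congr (_ * _);
  rewrite big_nseq prodr_const card_ord iter_mulr_1.
by rewrite mxE eqxx /= subr0 !mulr1 mulrC.
Qed.

(* Equality characterizes the linear span of the single-particle functions:
   sums such as phi(xi_1) + psi(xi_2) also attain it.  If n > 2 and only w_n
   can be nonzero, both sides equal w_n Var f for every f, so the converse
   needs some w_l > 0 with l < n. *)
Theorem theorem1p8 (R : realType) (V : finType) (n : nat)
    (cardV : #|V| = n) (n_ge2 : (2 <= n)%N) :
  (forall (w : nat -> R) (alpha : {set V} -> R),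
     (forall l, (2 <= l <= n)%N -> 0 <= w l) ->
     (forall A, alpha A = \sum_(2 <= l < n.+1) w l * level_weight R l A) ->
     let lam : R :=
       \sum_(2 <= l < n.+1) n%:R * w l / l%:R * 'C(n - 2, l - 2)%:R in
     [/\ is_spectral_gap alpha lam,
         (forall f : {perm V} -> R,
            in_span (@mean_zero_single_particle R V) f ->
            lam * variance f = dirichlet alpha f)
       & (n = 2%N \/ exists l, (2 <= l < n)%N /\ 0 < w l) ->
         forall f : {perm V} -> R,
           mean f = 0 -> lam * variance f = dirichlet alpha f ->
           in_span (@mean_zero_single_particle R V) f])
  /\
  (forall alpha : {set V} -> R,
     (forall A, 0 <= alpha A) ->
     (forall A B : {set V}, #|A| = #|B| -> alpha A = alpha B) ->
     exists lam : R,
       is_spectral_gap alpha lam /\ is_graph_gap (edge_weight alpha) lam).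
Proof.
subst n; split=> [w alpha w_ge0 alphaE lam|alpha alpha_ge0 alpha_card].
  have alphaw (A : {set V}) : (2 <= #|A|)%N -> alpha A = w #|A|.
    move=> A2; rewrite alphaE (bigD1_seq #|A|) ?iota_uniq//=; last first.
      by rewrite mem_index_iota A2 ltnS max_card.
    rewrite /level_weight eqxx mulr1 big1 ?addr0// => l /negPf.
    by rewrite eq_sym => ->; rewrite mulr0.
  have lamE : lam = \sum_(2 <= l < #|V|.+1) w l * level_gap R V l.
    by apply: eq_bigr => l _; rewrite /level_gap mulrA mulrCA mulrA.
  rewrite lamE; split.
  - exact: level_spectral_gap.
  - exact: in_span_equality.
  - by move=> W f; apply: equality_in_span.
(* The value of [alpha] on any set of size l; the default 0 occurs only for l > |V|. *)
pose w l := if [pick A : {set V} | #|A| == l] is Some A then alpha A else 0.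
have alphaw (A : {set V}) : (2 <= #|A|)%N -> alpha A = w #|A|.
  move=> _; rewrite /w; case: pickP => [B /eqP BA|/(_ A)]; last by rewrite eqxx.
  exact: alpha_card.
have w_ge0 l : (2 <= l <= #|V|)%N -> 0 <= w l.
  by move=> _; rewrite /w; case: pickP => // B _; apply: alpha_ge0.
pose lam : R := \sum_(2 <= l < #|V|.+1) w l * level_gap R V l.
have gap : is_spectral_gap alpha lam by apply: level_spectral_gap.
exists lam; split=> //.
have n0 : #|V|%:R != 0 :> R by rewrite pnatr_eq0 -(subnKC n_ge2).
have -> : lam = #|V|%:R * (lam / #|V|%:R) by rewrite mulrCA mulfV// mulr1.
apply: complete_graph_eigenvalue=> //.
  by case: gap => lam0 _ _; rewrite divr_ge0.
move=> i j; rewrite mxE /laplacian -sumrN; set a := lam / _.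
(* At y = [enum_val i], where the edge weight need not be [a], both sides vanish. *)
have E y : - (edge_weight alpha (enum_val i) y *
      ((y == enum_val j)%:R - (enum_val i == enum_val j)%:R)) =
    a * ((i == j)%:R - (y == enum_val j)%:R).
  rewrite (inj_eq enum_val_inj); have [->|yi] := eqVneq y (enum_val i).
    by rewrite (inj_eq enum_val_inj) !subrr !mulr0 oppr0.
  rewrite (edge_weight_levels n_ge2 alphaw) 1?eq_sym// -/lam -/a; ring.
rewrite (eq_bigr _ (fun y _ => E y)) -mulr_sumr sumrB sumr_const.
rewrite -[_ *+ _]mulr_natl (bigD1 (enum_val j))//= eqxx big1 ?addr0//.
by move=> y /negPf ->.
Qed.
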